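(* Let $N_S,N_R,N_D\ge 1$ be integers, let $\mathbf{H}_{DS}\in\mathbb{C}^{N_D\times N_S}$, $\mathbf{H}_{RS}\in\mathbb{C}^{N_R\times N_S}$, $\mathbf{H}_{DR}\in\mathbb{C}^{N_D\times N_R}$ be arbitrary matrices, let $\mathbf{H}=[\mathbf{H}_{DS}\;\mathbf{H}_{DR}]\in\mathbb{C}^{N_D\times(N_S+N_R)}$, let $\mathbf{D}_S=[\mathbf{I}\;\mathbf{0}]\in\mathbb{C}^{N_S\times(N_S+N_R)}$ and $\mathbf{D}_R=[\mathbf{0}\;\mathbf{I}]\in\mathbb{C}^{N_R\times(N_S+N_R)}$, and let $P_S,P_R>0$. For $\varepsilon>0$ define $$\mathcal{P}_\varepsilon=\big\{(\mathbf{C},\mathbf{R}) : \mathbf{C}\in\mathbb{C}^{N_S\times N_S},\ \mathbf{C}\succeq\varepsilon\mathbf{I},\ \mathbf{R}\in\mathbb{C}^{(N_S+N_R)\times(N_S+N_R)},\ \mathbf{R}\succeq\mathbf{0},\ \operatorname{tr}(\mathbf{C})+\operatorname{tr}(\mathbf{D}_S\mathbf{R}\mathbf{D}_S^{H})\le P_S,\ \operatorname{tr}(\mathbf{D}_R\mathbf{R}\mathbf{D}_R^{H})\le P_R\big\}.$$ For $\mathbf{C}_v,\mathbf{C}_w\succeq \mathbf{0}$ in $\mathbb{C}^{N_S\times N_S}$ let $$R_A(\mathbf{C}_v,\mathbf{C}_w)=\log_2\det(\mathbf{I}+\mathbf{H}_{DS}\mathbf{C}_v\mathbf{H}_{DS}^H)+\log_2\frac{\det(\mathbf{I}+\mathbf{H}_{RS}(\mathbf{C}_v+\mathbf{C}_w)\mathbf{H}_{RS}^H)}{\det(\mathbf{I}+\mathbf{H}_{RS}\mathbf{C}_v\mathbf{H}_{RS}^H)},$$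 and for $\mathbf{C}\succeq\mathbf{0}$ let $R_A^\star(\mathbf{C})=\max\{R_A(\mathbf{C}_v,\mathbf{C}_w): \mathbf{C}_v\succeq\mathbf{0},\ \mathbf{C}_w\succeq\mathbf{0},\ \mathbf{C}_v+\mathbf{C}_w\preceq\mathbf{C}\}$. Further let $R_B(\mathbf{C},\mathbf{R})=\log_2\det(\mathbf{I}+\mathbf{H}_{DS}\mathbf{C}\mathbf{H}_{DS}^H+\mathbf{H}\mathbf{R}\mathbf{H}^H)$. Then, for every $\varepsilon>0$, the optimization problem $$\max_{(\mathbf{C},\mathbf{R})\in\mathcal{P}_\varepsilon}\ \min\{R_A^\star(\mathbf{C}),\,R_B(\mathbf{C},\mathbf{R})\}$$ is a convex program, i.e., $\mathcal{P}_\varepsilon$ is a convex set and the objective $(\mathbf{C},\mathbf{R})\mapsto\min\{R_A^\star(\mathbf{C}),R_B(\mathbf{C},\mathbf{R})\}$ is concave on $\mathcal{P}_\varepsilon$.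
   Context: All matrices are complex; $\succeq$ and $\succ$ denote positive semidefiniteness and positive definiteness of Hermitian matrices (and $\mathbf{A}\preceq\mathbf{B}$ means $\mathbf{B}-\mathbf{A}\succeq\mathbf{0}$); $\cdot^H$ is the conjugate transpose; $\mathbf{I}$ and $\mathbf{0}$ are identity and zero matrices of appropriate sizes. This problem models the maximization of the partial decode-and-forward rate in a Gaussian MIMO relay channel with source S, relay R and destination D, where $\mathbf{C}$ is an (innovation) covariance matrix and $\mathbf{R}$ a joint covariance matrix. *)

(* Defs.v *)
From mathcomp Require Import all_boot all_order all_algebra complex.
From mathcomp Require Import classical_sets reals exp.
Set Implicit Arguments. Unset Strict Implicit. Unset Printing Implicit Defensive.
Import Order.TTheory GRing.Theory Num.Theory.
Local Open Scope ring_scope.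
Local Open Scope complex_scope.
Local Open Scope classical_set_scope.

Section Defs.
Variable R : realType.
Local Notation C := (R[i]).

Definition ctr (m n : nat) (A : 'M[C]_(m, n)) : 'M[C]_(n, m) := (map_mx conjc A)^T.

Definition psd (n : nat) (A : 'M[C]_n) : Prop :=
  ctr A = A /\ forall x : 'cV[C]_n, 0 <= (ctr x *m A *m x) 0 0.

Definition loew (n : nat) (A B : 'M[C]_n) : Prop := psd (B - A).

Definition log2 (x : R) : R := ln x / ln 2.

(* log2 det of a (Hermitian positive definite) matrix; its determinant is real *)
Definition log2det (n : nat) (M : 'M[C]_n) : R := log2 (complex.Re (\det M)).

Variables (nS nR nD : nat).
Variables (HDS : 'M[C]_(nD, nS)) (HRS : 'M[C]_(nR, nS)) (HDR : 'M[C]_(nD, nR)).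

Definition Hmat : 'M[C]_(nD, nS + nR) := row_mx HDS HDR.
Definition DS : 'M[C]_(nS, nS + nR) := row_mx 1%:M 0.
Definition DR : 'M[C]_(nR, nS + nR) := row_mx 0 1%:M.

Definition RA (Cv Cw : 'M[C]_nS) : R :=
  log2det (1%:M + HDS *m Cv *m ctr HDS)
  + log2 (complex.Re (\det (1%:M + HRS *m (Cv + Cw) *m ctr HRS))
          / complex.Re (\det (1%:M + HRS *m Cv *m ctr HRS))).

Definition RAstar (Cm : 'M[C]_nS) : R :=
  sup [set r | exists Cv Cw : 'M[C]_nS,
         [/\ psd Cv, psd Cw, loew (Cv + Cw) Cm & r = RA Cv Cw]].

Definition RB (Cm : 'M[C]_nS) (Rm : 'M[C]_(nS + nR)) : R :=
  log2det (1%:M + HDS *m Cm *m ctr HDS + Hmat *m Rm *m ctr Hmat).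

Definition objective (Cm : 'M[C]_nS) (Rm : 'M[C]_(nS + nR)) : R :=
  Num.min (RAstar Cm) (RB Cm Rm).

Definition Peps (PS PR eps : R) (Cm : 'M[C]_nS) (Rm : 'M[C]_(nS + nR)) : Prop :=
  [/\ loew (eps%:C *: 1%:M) Cm, psd Rm,
      \tr Cm + \tr (DS *m Rm *m ctr DS) <= PS%:C
    & \tr (DR *m Rm *m ctr DR) <= PR%:C].

End Defs.

(* Main.v *)
Require Import Defs.
From mathcomp Require Import all_boot all_order all_algebra complex.
From mathcomp Require Import classical_sets reals interval_inference convex exp.
Import Order.TTheory GRing.Theory Num.Theory.
Local Open Scope ring_scope.
Local Open Scope complex_scope.
Set Implicit Arguments. Unset Strict Implicit.

(* For positive definite [C], the rate [RAstar C] is the minimum of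
   [log2 det (I + K C K^H)] over the [W = K^H K] that dominate both [HDS^H HDS]
   and [HRS^H HRS].  Each of these functions is concave in [C], and a minimum of
   concave functions is concave; [RB] is the log-determinant of an affine
   positive definite function of [(C, R)].
   That each such [W] gives an upper bound follows from the monotonicity of the
   Schur complement.  The bound is attained because [C^-1 + HRS^H HRS] and
   [C^-1 + HDS^H HDS] can be diagonalized by the same congruence: take for
   [C^-1 + W] the entrywise maximum in these coordinates. *)

(** * Algebra of the conjugate transpose *)

Section Hermitian.
Variable R : realType.
Local Notation C := (R[i]).
Local Notation rmx := (map_mx (real_complex R)).

Lemma ctrK m n (A : 'M[C]_(m, n)) : ctr (ctr A) = A.
Proof. by apply/matrixP=> i j; rewrite !mxE conjcK. Qed.

Lemma ctrM m n p (A : 'M[C]_(m, n)) (B : 'M[C]_(n, p)) :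
  ctr (A *m B) = ctr B *m ctr A.
Proof. by rewrite /ctr map_mxM trmx_mul. Qed.

Lemma ctrD m n (A B : 'M[C]_(m, n)) : ctr (A + B) = ctr A + ctr B.
Proof. by apply/matrixP=> i j; rewrite !mxE rmorphD. Qed.

Lemma ctrB m n (A B : 'M[C]_(m, n)) : ctr (A - B) = ctr A - ctr B.
Proof. by apply/matrixP=> i j; rewrite !mxE rmorphB. Qed.

Lemma ctr1 n : ctr 1%:M = 1%:M :> 'M[C]_n.
Proof. by rewrite /ctr map_mx1 trmx1. Qed.

Lemma ctr0 m n : ctr 0 = 0 :> 'M[C]_(m, n).
Proof. by rewrite /ctr map_mx0 trmx0. Qed.

Lemma ctrZ m n (a : R) (A : 'M[C]_(m, n)) : ctr (a%:C *: A) = a%:C *: ctr A.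
Proof.
by apply/matrixP=> i j; rewrite !mxE rmorphM; congr (_ * _); exact: conjc_real.
Qed.

Lemma ctr_row_mx m n p (A : 'M[C]_(m, n)) (B : 'M[C]_(m, p)) :
  ctr (row_mx A B) = col_mx (ctr A) (ctr B).
Proof. by rewrite /ctr map_row_mx tr_row_mx. Qed.

Lemma ctr_col_mx m n p (A : 'M[C]_(m, n)) (B : 'M[C]_(p, n)) :
  ctr (col_mx A B) = row_mx (ctr A) (ctr B).
Proof. by rewrite /ctr map_col_mx tr_col_mx. Qed.

Lemma ctr_block_mx m n p q (A : 'M[C]_(m, n)) (B : 'M[C]_(m, p))
    (D : 'M[C]_(q, n)) (E : 'M[C]_(q, p)) :
  ctr (block_mx A B D E) = block_mx (ctr A) (ctr D) (ctr B) (ctr E).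
Proof. by rewrite /ctr map_block_mx tr_block_mx. Qed.

Lemma ctr_diag n (d : 'rV[R]_n) : ctr (diag_mx (rmx d)) = diag_mx (rmx d).
Proof.
apply/matrixP=> i j; rewrite !mxE eq_sym.
by case: eqP => [->|_]; rewrite ?mulr1n ?conjc_real ?mulr0n ?conjc0.
Qed.

Lemma det_ctr n (A : 'M[C]_n) : \det (ctr A) = conjc (\det A).
Proof. by rewrite det_tr det_map_mx. Qed.

Lemma unitmx_ctr n (A : 'M[C]_n) : (ctr A \in unitmx) = (A \in unitmx).
Proof. by rewrite unitmx_tr map_unitmx. Qed.

Lemma ctr_inv n (A : 'M[C]_n) : ctr (invmx A) = invmx (ctr A).
Proof. by rewrite /ctr map_invmx trmx_inv. Qed.

(** * Definite and semidefinite matrices, and their congruences *)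

Definition pd n (A : 'M[C]_n) : Prop :=
  ctr A = A /\ forall x : 'cV[C]_n, x != 0 -> 0 < (ctr x *m A *m x) 0 0.

Lemma sqnorm_ge0 n (x : 'cV[C]_n) : 0 <= (ctr x *m x) 0 0.
Proof.
by rewrite mxE sumr_ge0 // => i _; rewrite !mxE mulrC mulcJ_ge0.
Qed.

Lemma sqnorm_gt0 n (x : 'cV[C]_n) : x != 0 -> 0 < (ctr x *m x) 0 0.
Proof.
move=> xn0; rewrite lt0r sqnorm_ge0 andbT; apply: contraNneq xn0 => x0.
apply/eqP/matrixP=> i j; rewrite (ord1 j) mxE.
have := x0; rewrite mxE => /eqP; rewrite psumr_eq0; last first.
  by move=> k _; rewrite !mxE mulrC mulcJ_ge0.
by move=> /allP/(_ i (mem_index_enum _)); rewrite !mxE mulf_eq0 conjc_eq0 orbb => /eqP.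
Qed.

Lemma psd_gram m n (A : 'M[C]_(m, n)) : psd (ctr A *m A).
Proof.
split=> [|x]; first by rewrite ctrM ctrK.
by rewrite !mulmxA -ctrM -mulmxA sqnorm_ge0.
Qed.

Lemma psd_congr m n (A : 'M[C]_n) (X : 'M[C]_(n, m)) :
  psd A -> psd (ctr X *m A *m X).
Proof.
case=> hA pA; split=> [|x]; first by rewrite !ctrM ctrK hA mulmxA.
by have := pA (X *m x); rewrite ctrM !mulmxA.
Qed.

Lemma psd_congrV m n (A : 'M[C]_n) (X : 'M[C]_(m, n)) :
  psd A -> psd (X *m A *m ctr X).
Proof. by move=> /(psd_congr (ctr X)); rewrite ctrK. Qed.

Lemma psdD n (A B : 'M[C]_n) : psd A -> psd B -> psd (A + B).
Proof.
move=> [hA pA] [hB pB]; split=> [|x]; first by rewrite ctrD hA hB.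
by rewrite mulmxDr mulmxDl mxE addr_ge0.
Qed.

Lemma psd0 n : psd (0 : 'M[C]_n).
Proof. by split=> [|x]; rewrite ?ctr0 // mulmx0 mul0mx mxE. Qed.

Lemma psdZ n (a : R) (A : 'M[C]_n) : 0 <= a -> psd A -> psd (a%:C *: A).
Proof.
move=> a0 [hA pA]; split=> [|x]; first by rewrite ctrZ hA.
by rewrite -scalemxAr -scalemxAl mxE mulr_ge0 // ler0c.
Qed.

Lemma pd_psd n (A : 'M[C]_n) : pd A -> psd A.
Proof.
case=> hA pA; split=> // x; have [->|/pA/ltW//] := eqVneq x 0.
by rewrite mulmx0 mxE.
Qed.

Lemma pd1 n : pd (1%:M : 'M[C]_n).
Proof. by split=> [|x]; rewrite ?ctr1 // mulmx1; apply: sqnorm_gt0. Qed.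

Lemma pdD n (A B : 'M[C]_n) : pd A -> psd B -> pd (A + B).
Proof.
move=> [hA pA] [hB pB]; split=> [|x x0]; first by rewrite ctrD hA hB.
by rewrite mulmxDr mulmxDl mxE ltr_wpDr // pA.
Qed.

Lemma pdZ n (a : R) (A : 'M[C]_n) : 0 < a -> pd A -> pd (a%:C *: A).
Proof.
move=> a0 [hA pA]; split=> [|x x0]; first by rewrite ctrZ hA.
by rewrite -scalemxAr -scalemxAl mxE mulr_gt0 ?pA // ltcR.
Qed.

(** The left inverse [Y] makes [X] injective without making it square, so compressions to corners
    and to selected coordinates are covered. *)
Lemma pd_congr m n (A : 'M[C]_n) (X : 'M[C]_(n, m)) (Y : 'M[C]_(m, n)) :
  Y *m X = 1%:M -> pd A -> pd (ctr X *m A *m X).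
Proof.
move=> YX [hA pA]; split=> [|x x0]; first by rewrite !ctrM ctrK hA mulmxA.
have /pA : X *m x != 0.
  apply: contraNneq x0 => Xx0.
  by rewrite -[x]mul1mx -YX -mulmxA Xx0 mulmx0.
by rewrite ctrM !mulmxA.
Qed.

Lemma pd_unit n (A : 'M[C]_n) : pd A -> A \in unitmx.
Proof.
case=> _ pA; rewrite unitmxE unitfE; apply/det0P => -[v v0 vA].
have /pA : ctr v != 0 by apply: contraNneq v0 => v0; rewrite -[v]ctrK v0 ctr0.
by rewrite ctrK vA mul0mx mxE ltxx.
Qed.

Lemma pd_inv n (A : 'M[C]_n) : pd A -> pd (invmx A).
Proof.
move=> pA; have uA := pd_unit pA.
have -> : invmx A = ctr (invmx A) *m A *m invmx A.
  by rewrite ctr_inv pA.1 mulVmx // mul1mx.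
exact: (pd_congr (mulmxV uA)).
Qed.

(** * Spectral decomposition and simultaneous diagonalization *)

Lemma spectral n (A : 'M[C]_n) : ctr A = A ->
  exists (U : 'M[C]_n) (d : 'rV[R]_n),
    ctr U *m U = 1%:M /\ A = ctr U *m diag_mx (rmx d) *m U.
Proof.
move=> hA; have hermA : A \is hermsymmx.
  by apply/is_hermitianmxP; rewrite expr0 scale1r -[LHS]hA /ctr map_trmx.
pose U := spectralmx A; have U_unitary : U \is unitarymx := spectral_unitarymx A.
have UV : invmx U = ctr U by rewrite invmx_unitary // /ctr map_trmx.
have uU := unitarymx_unit U_unitary.
(* Eigenvalues of a Hermitian matrix are real, so taking real parts loses nothing and gives a
   diagonal over [R]. *)
exists U, (map_mx (@complex.Re R) (spectral_diag A)); split.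
  by rewrite -UV mulVmx.
have /orthomx_spectralP {1}-> := hermitian_normalmx hermA.
rewrite -/U UV; congr (_ *m diag_mx _ *m _); apply/matrixP=> i j.
have /mxOverP/(_ i j)/RRe_real <- := hermitian_spectral_diag_real hermA.
by rewrite !mxE.
Qed.

Lemma diag_form n (T : 'M[C]_n) (d : 'rV[R]_n) :
  psd (ctr T *m diag_mx (rmx d) *m T) -> T \in unitmx -> forall i, 0 <= d 0 i.
Proof.
(* At [T^-1 e_i] the quadratic form takes the value [d_i]. *)
move=> [_ pA] uT i; have := pA (invmx T *m delta_mx i 0).
rewrite ctrM ctr_inv !mulmxA mulmxKV ?unitmx_ctr // mulmxK //.
rewrite /ctr map_delta_mx trmx_delta -rowE -colE !mxE eqxx mulr1n.
by rewrite ler0c.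
Qed.

Lemma psd_diag_form n (T : 'M[C]_n) (d : 'rV[R]_n) :
  (forall i, 0 <= d 0 i) -> psd (ctr T *m diag_mx (rmx d) *m T).
Proof.
move=> d0; apply: psd_congr.
have -> : diag_mx (rmx d) = ctr (diag_mx (rmx (map_mx Num.sqrt d))) *m
                            diag_mx (rmx (map_mx Num.sqrt d)).
  rewrite ctr_diag mulmx_diag; congr diag_mx; apply/matrixP=> i j.
  by rewrite !mxE -rmorphM -expr2 (ord1 i) sqr_sqrtr.
exact: psd_gram.
Qed.

Lemma psd_factor n (A : 'M[C]_n) :
  psd A -> exists K : 'M[C]_n, A = ctr K *m K.
Proof.
move=> pA; have [U [d [UU dA]]] := spectral pA.1.
have uU : U \in unitmx by case: (mulmx1_unit UU).
have d0 : forall i, 0 <= d 0 i by apply: (diag_form (T := U)); rewrite -?dA.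
exists (diag_mx (rmx (map_mx Num.sqrt d)) *m U).
rewrite ctrM ctr_diag !mulmxA -[_ *m diag_mx _ *m diag_mx _]mulmxA mulmx_diag dA.
congr (_ *m diag_mx _ *m _); apply/matrixP=> i j.
by rewrite !mxE -rmorphM -expr2 (ord1 i) sqr_sqrtr.
Qed.

Lemma psd_factorV n (A : 'M[C]_n) :
  psd A -> exists K : 'M[C]_n, A = K *m ctr K.
Proof. by move=> /psd_factor[K ->]; exists (ctr K); rewrite ctrK. Qed.

(** Write [P = L^H L] and diagonalize the Hermitian matrix [L^-H Q L^-1] by a unitary [U]; then
    [T = U L] serves both forms. *)
Lemma simdiag n (P Q : 'M[C]_n) : pd P -> ctr Q = Q ->
  exists (T : 'M[C]_n) (d : 'rV[R]_n),
    [/\ T \in unitmx, P = ctr T *m T & Q = ctr T *m diag_mx (rmx d) *m T].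
Proof.
move=> pP hQ; have [L PL] := psd_factor (pd_psd pP).
have uL : L \in unitmx.
  by have := pd_unit pP; rewrite PL unitmx_mul => /andP[].
have [|U [d [UU dQ]]] := @spectral _ (ctr (invmx L) *m Q *m invmx L).
  by rewrite !ctrM ctrK hQ mulmxA.
exists (U *m L), d; split.
- by rewrite unitmx_mul uL andbT; case: (mulmx1_unit UU).
- by rewrite ctrM mulmxA -[_ *m ctr U *m U]mulmxA UU mulmx1.
- have -> : Q = ctr L *m (ctr (invmx L) *m Q *m invmx L) *m L.
    by rewrite ctr_inv !mulmxA mulmxKV // mulmxV ?unitmx_ctr // mul1mx.
  by rewrite dQ ctrM !mulmxA.
Qed.

(** * Determinants and the semidefinite order *)

Lemma det_diag_form n (T : 'M[C]_n) (d : 'rV[R]_n) :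
  \det (ctr T *m diag_mx (rmx d) *m T)
  = \det (ctr T *m T) * (\prod_i d 0 i)%:C.
Proof.
rewrite !det_mulmx det_diag mulrAC; congr (_ * _).
by rewrite rmorph_prod; apply: eq_bigr => i _; rewrite mxE.
Qed.

Lemma det_gram_gt0 n (T : 'M[C]_n) : T \in unitmx -> 0 < \det (ctr T *m T).
Proof.
rewrite unitmxE unitfE => uT; rewrite det_mulmx det_ctr mulrC lt0r mulcJ_ge0.
by rewrite mulf_neq0 // conjc_eq0.
Qed.

Lemma det_pd n (P : 'M[C]_n) : pd P -> 0 < \det P.
Proof.
by move=> pP; have [T [d [uT -> _]]] := simdiag pP pP.1; apply: det_gram_gt0.
Qed.

(** Simultaneous diagonalization turns [P] into [I] and [Q - P] into a nonnegative diagonal [d], so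
    the ratio of the determinants is the product of the [1 + d_i]. *)
Lemma det_le n (P Q : 'M[C]_n) : pd P -> psd (Q - P) -> \det P <= \det Q.
Proof.
move=> pP pQP; have [T [d [uT PT dQP]]] := simdiag pP pQP.1.
have d0 : forall i, 0 <= d 0 i by apply: (diag_form (T := T)); rewrite -?dQP.
have -> : Q = ctr T *m diag_mx (rmx (const_mx 1 + d)) *m T.
  rewrite -[LHS](subrK P) dQP PT map_mxD raddfD /= map_const_mx.
  by rewrite diag_const_mx mulmxDr mulmxDl mulmx1 addrC.
rewrite det_diag_form PT ler_peMr //; first by rewrite ltW // det_gram_gt0.
have d1 : 1 <= \prod_i (const_mx 1 + d) 0 i :> R.
  have {1}-> : 1 = \prod_(i < n) 1 :> R by rewrite big1_eq.
  by apply: ler_prod => i _; rewrite !mxE ler01 lerDl d0.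
by rewrite -(lecR 1) in d1.
Qed.

End Hermitian.

(** * Determinant identities and corners of block matrices *)

Section Determinants.
Variable R : realType.
Local Notation C := (R[i]).
Local Notation rmx := (map_mx (real_complex R)).

(** Sylvester's identity: one block matrix is factored into block triangular matrices in two
    ways. *)
Lemma det_add1_mulC m n (X : 'M[C]_(m, n)) (Y : 'M[C]_(n, m)) :
  \det (1%:M + X *m Y) = \det (1%:M + Y *m X).
Proof.
have E1 : block_mx 1%:M (- X) Y 1%:M
    = block_mx 1%:M 0 Y 1%:M *m block_mx 1%:M (- X) 0 (1%:M + Y *m X).
  by rewrite mulmx_block !mulmx1 !mul1mx !mulmx0 !mul0mx !addr0 mulmxN addrCA addNr addr0.
have E2 : block_mx 1%:M (- X) Y 1%:M
    = block_mx 1%:M (- X) 0 1%:M *m block_mx (1%:M + X *m Y) 0 Y 1%:M.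
  by rewrite mulmx_block !mulmx1 !mul1mx !mul0mx !add0r mulNmx addrK.
have := congr1 determinant E2.
by rewrite {1}E1 !det_mulmx !det_lblock !det_ublock !det1 !(mul1r, mulr1).
Qed.

(** Seen as congruences, the diagonal corners inherit definiteness and semidefiniteness. *)
Lemma ulsubmx_congr m n (M : 'M[C]_(m + n)) :
  ulsubmx M = ctr (col_mx 1%:M 0) *m M *m col_mx 1%:M 0.
Proof.
rewrite ctr_col_mx ctr1 ctr0 -{2}[M]submxK mul_row_block mul_row_col.
by rewrite !mul1mx !mul0mx !mulmx1 !mulmx0 !addr0.
Qed.

Lemma drsubmx_congr m n (M : 'M[C]_(m + n)) :
  drsubmx M = ctr (col_mx 0 1%:M) *m M *m col_mx 0 1%:M.
Proof.
rewrite ctr_col_mx ctr1 ctr0 -{2}[M]submxK mul_row_block mul_row_col.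
by rewrite !mul1mx !mul0mx !mulmx1 !mulmx0 !add0r.
Qed.

Lemma ulsubmxB m n (M N : 'M[C]_(m + n)) :
  ulsubmx (M - N) = ulsubmx M - ulsubmx N.
Proof. by rewrite !ulsubmx_congr mulmxBr mulmxBl. Qed.

Lemma drsubmxB m n (M N : 'M[C]_(m + n)) :
  drsubmx (M - N) = drsubmx M - drsubmx N.
Proof. by rewrite !drsubmx_congr mulmxBr mulmxBl. Qed.

Lemma psd_ulsubmx m n (M : 'M[C]_(m + n)) : psd M -> psd (ulsubmx M).
Proof. by rewrite ulsubmx_congr; apply: psd_congr. Qed.

Lemma psd_drsubmx m n (M : 'M[C]_(m + n)) : psd M -> psd (drsubmx M).
Proof. by rewrite drsubmx_congr; apply: psd_congr. Qed.

Lemma pd_ulsubmx m n (M : 'M[C]_(m + n)) : pd M -> pd (ulsubmx M).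
Proof.
rewrite ulsubmx_congr; apply: (@pd_congr _ _ _ _ _ (row_mx 1%:M 0)).
by rewrite mul_row_col mulmx1 mulmx0 addr0.
Qed.

Lemma pd_drsubmx m n (M : 'M[C]_(m + n)) : pd M -> pd (drsubmx M).
Proof.
rewrite drsubmx_congr; apply: (@pd_congr _ _ _ _ _ (row_mx 0 1%:M)).
by rewrite mul_row_col mulmx1 mulmx0 add0r.
Qed.

(** * Schur complements *)

Definition schur m n (M : 'M[C]_(m + n)) : 'M[C]_n :=
  drsubmx M - dlsubmx M *m invmx (ulsubmx M) *m ursubmx M.

(** The block column operation that clears the upper right block; for Hermitian [M] its conjugate
    transpose clears the lower left one. *)
Definition schur_elim m n (M : 'M[C]_(m + n)) : 'M[C]_(m + n) :=
  block_mx 1%:M (- (invmx (ulsubmx M) *m ursubmx M)) 0 1%:M.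

Lemma schur_elim_unit m n (M : 'M[C]_(m + n)) : schur_elim M \in unitmx.
Proof. by rewrite unitmxE det_ublock !det1 mulr1 unitr1. Qed.

Lemma ctr_ursubmx m n (M : 'M[C]_(m + n)) :
  ctr M = M -> dlsubmx M = ctr (ursubmx M).
Proof. by move=> hM; rewrite -{1}hM /ctr map_ursubmx trmx_ursub. Qed.

Lemma schur_elimE m n (M : 'M[C]_(m + n)) : pd M ->
  ctr (schur_elim M) *m M *m schur_elim M = block_mx (ulsubmx M) 0 0 (schur M).
Proof.
move=> pM; have pA := pd_ulsubmx pM; have uA := pd_unit pA.
rewrite -{2}[M]submxK /schur_elim ctr_block_mx !ctr1 ctr0 !mulmx_block.
rewrite -[- _]sub0r ctrB ctr0 ctrM ctr_inv pA.1 -ctr_ursubmx ?pM.1 // !sub0r.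
rewrite !(mul1mx, mulmx1, mul0mx, mulmx0, addr0, add0r).
by rewrite !mulNmx mulmxKV // addNr mul0mx add0r !mulmxN mulKVmx // addNr addrC.
Qed.

Lemma det_schur m n (M : 'M[C]_(m + n)) : pd M ->
  \det M = \det (ulsubmx M) * \det (schur M).
Proof.
move=> /schur_elimE/(congr1 determinant).
by rewrite !det_mulmx det_ctr !det_ublock !det1 mulr1 conjc1 mul1r mulr1.
Qed.

(** Fischer's inequality: the Schur complement arises from the lower right block by subtracting a
    semidefinite matrix. *)
Lemma det_fischer m n (M : 'M[C]_(m + n)) : pd M ->
  \det M <= \det (ulsubmx M) * \det (drsubmx M).
Proof.
move=> pM; have pA := pd_ulsubmx pM; rewrite det_schur // ler_pM2l ?det_pd //.
have pB : pd (block_mx (ulsubmx M) 0 0 (schur M)).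
  by rewrite -schur_elimE //; apply: pd_congr pM; apply: mulVmx (schur_elim_unit _).
apply: det_le; first by have := pd_drsubmx pB; rewrite block_mxKdr.
rewrite opprB addrCA subrr addr0 ctr_ursubmx ?pM.1 //.
exact/psd_congr/pd_psd/pd_inv.
Qed.

(* The second factor of [det M] is the Schur complement of the corner, which
   is the minimum of the lower right blocks of the congruences [E^H M E] by
   unipotent upper triangular [E]; hence it is monotone in [M]. *)
Lemma det_corner_le m n (M N : 'M[C]_(m + n)) : pd M -> psd (N - M) ->
  \det M * \det (ulsubmx N) <= \det N * \det (ulsubmx M).
Proof.
move=> pM pNM; have pN : pd N by rewrite -[N](addrNK M) addrC; apply: pdD.
have pA := pd_ulsubmx pN.
set E := schur_elim N; pose M' := ctr E *m M *m E.
have pM' : pd M' by apply: pd_congr pM; apply: mulVmx (schur_elim_unit _).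
have detM : \det M = \det M'.
  by rewrite !det_mulmx det_ctr !det_ublock !det1 !mulr1 conjc1 mul1r.
have ulM : ulsubmx M' = ulsubmx M.
  rewrite /M' /E /schur_elim ctr_block_mx !ctr1 ctr0 -{1}[M]submxK !mulmx_block.
  by rewrite block_mxKul !(mul1mx, mulmx1, mul0mx, mulmx0, addr0, add0r).
have pS : psd (schur N - drsubmx M').
  have := psd_drsubmx (psd_congr E pNM).
  by rewrite mulmxBr mulmxBl drsubmxB schur_elimE // block_mxKdr.
rewrite detM (det_schur pN) mulrC -mulrA ler_pM2l ?det_pd //.
(* The elimination for [N] need not block-diagonalize [M'], so Fischer's inequality takes the place
   of the determinant formula. *)
rewrite (le_trans (det_fischer pM')) // ulM mulrC ler_pM2r ?det_pd //.
  by apply: det_le pS; apply: pd_drsubmx.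
exact: pd_ulsubmx.
Qed.

(** * Duality between covariances and dominating matrices *)

Lemma pd_add1 m n (H : 'M[C]_(m, n)) (V : 'M[C]_n) :
  psd V -> pd (1%:M + H *m V *m ctr H).
Proof. by move=> pV; apply: pdD (pd1 _ _) (psd_congrV _ pV). Qed.

Lemma det_add1_le m n (H : 'M[C]_(m, n)) (V S : 'M[C]_n) :
  psd V -> psd (S - V) ->
  \det (1%:M + H *m V *m ctr H) <= \det (1%:M + H *m S *m ctr H).
Proof.
move=> pV pSV; apply: det_le; first exact: pd_add1.
by rewrite opprD addrACA subrr add0r -mulmxBl -mulmxBr; apply: psd_congrV.
Qed.

(** With [V = Y Y^H], [C - V = U U^H] and [F = [Y U]], Sylvester's identity replaces [I + H C H^H]
    by [I + F^H H^H H F]. The upper left corner of the latter has determinant [det (I + H V H^H)],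
    so [det_corner_le] compares [HR] with [K]. *)
Lemma weak_duality nS nR nD nK (HD : 'M[C]_(nD, nS)) (HR : 'M[C]_(nR, nS))
    (K : 'M[C]_(nK, nS)) (Cm V S : 'M[C]_nS) :
  psd (ctr K *m K - ctr HD *m HD) -> psd (ctr K *m K - ctr HR *m HR) ->
  psd V -> psd (S - V) -> psd (Cm - S) ->
  \det (1%:M + HD *m V *m ctr HD) * \det (1%:M + HR *m S *m ctr HR)
  <= \det (1%:M + K *m Cm *m ctr K) * \det (1%:M + HR *m V *m ctr HR).
Proof.
move=> pWA pWB pV pSV pCS.
have [Y VY] := psd_factorV pV.
have pCV : psd (Cm - V) by rewrite -(addrNK S Cm) -addrA; exact: psdD pCS pSV.
have [U CU] := psd_factorV pCV.
pose F := row_mx Y U.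
have CF : Cm = F *m ctr F by rewrite ctr_row_mx mul_row_col -VY -CU addrC subrK.
pose gram k (H : 'M[C]_(k, nS)) := 1%:M + ctr F *m (ctr H *m H) *m F.
have det_gram k (H : 'M[C]_(k, nS)) :
    \det (gram k H) = \det (1%:M + H *m Cm *m ctr H).
  by rewrite CF -!mulmxA [in RHS]mulmxA det_add1_mulC /gram !mulmxA.
have ul_gram k (H : 'M[C]_(k, nS)) :
    ulsubmx (gram k H) = 1%:M + ctr Y *m (ctr H *m H) *m Y.
  rewrite /gram -mulmxA ctr_row_mx mul_mx_row mul_col_row scalar_mx_block.
  by rewrite add_block_mx block_mxKul !mulmxA.
have det_ul k (H : 'M[C]_(k, nS)) :
    \det (ulsubmx (gram k H)) = \det (1%:M + H *m V *m ctr H).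
  by rewrite ul_gram VY -!mulmxA [in RHS]mulmxA [in RHS]det_add1_mulC !mulmxA.
have pd_gram k (H : 'M[C]_(k, nS)) : pd (gram k H).
  apply: pdD (pd1 _ _) _; exact/psd_congr/psd_gram.
have gramB : psd (gram nK K - gram nR HR).
  rewrite /gram opprD addrACA subrr add0r -mulmxBl -mulmxBr; exact: psd_congr pWB.
have gramA : \det (1%:M + HD *m V *m ctr HD) <= \det (ulsubmx (gram nK K)).
  rewrite -det_ul; apply: det_le; first exact: pd_ulsubmx.
  rewrite -ulsubmxB; apply: psd_ulsubmx.
  rewrite /gram opprD addrACA subrr add0r -mulmxBl -mulmxBr; exact: psd_congr pWA.
have pS : psd S by rewrite -(subrK V S); exact: psdD pSV pV.
rewrite -(det_gram _ K) -(det_ul _ HR) mulrC.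
(* Both factors on the left are first enlarged: [S] to [C], and [HD] to [K]. *)
apply: le_trans (det_corner_le (pd_gram _ HR) gramB).
apply: ler_pM; last by exact: gramA.
- exact/ltW/det_pd/pd_add1.
- exact/ltW/det_pd/pd_add1.
- by rewrite det_gram; apply: det_add1_le.
Qed.

(** Sylvester's identity moves [X] to the left, and the factor [det G] clears the inverse. *)
Lemma det_add1_compress m n k (H : 'M[C]_(m, n)) (X : 'M[C]_(n, k)) (G : 'M[C]_k) :
  G \in unitmx ->
  \det (1%:M + H *m (X *m invmx G *m ctr X) *m ctr H) * \det G
  = \det (G + ctr X *m (ctr H *m H) *m X).
Proof.
move=> uG; rewrite -!mulmxA mulmxA det_add1_mulC mulrC -det_mulmx mulmxDr mulmx1.
by rewrite !mulmxA (mulmxV uG) mul1mx.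
Qed.

Lemma diag_colsub_congr k n (g : 'I_k -> 'I_n) (f : 'rV[R]_n) : injective g ->
  ctr (colsub g 1%:M) *m diag_mx (rmx f) *m colsub g 1%:M
  = diag_mx (rmx (colsub g f)).
Proof.
move=> g_inj; rewrite mulmx_colsub mulmx1.
apply/matrixP=> i j; rewrite !mxE (bigD1 (g i)) //= big1 ?addr0 => [|l lgi].
  by rewrite !mxE eqxx conjc1 mul1r (inj_eq g_inj).
by rewrite !mxE (negPf lgi) conjc0 mul0r.
Qed.

(* In the coordinates [T] that diagonalize [C^-1 + HR^H HR] and
   [C^-1 + HD^H HD] simultaneously, to [1] and [d], the multiplier is given by
   [C^-1 + W = max (1, d)], and [V C^-1] is the projection onto the span of the
   generalized eigenvectors for [d_i > 1]. *)
Lemma strong_duality nS nR nD (HD : 'M[C]_(nD, nS)) (HR : 'M[C]_(nR, nS))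
    (Cm : 'M[C]_nS) : pd Cm ->
  exists K V : 'M[C]_nS,
    [/\ psd (ctr K *m K - ctr HD *m HD), psd (ctr K *m K - ctr HR *m HR),
        psd V, psd (Cm - V) &
        \det (1%:M + HD *m V *m ctr HD) * \det (1%:M + HR *m Cm *m ctr HR)
        = \det (1%:M + K *m Cm *m ctr K) * \det (1%:M + HR *m V *m ctr HR)].
Proof.
move=> pC; have pCi := pd_inv pC; have uC := pd_unit pC.
set Ci := invmx Cm in pCi; have uCi := pd_unit pCi.
have pQ : pd (Ci + ctr HR *m HR) by apply: pdD pCi (psd_gram _).
have pP : pd (Ci + ctr HD *m HD) by apply: pdD pCi (psd_gram _).
have [T [d [uT QT PT]]] := simdiag pQ pP.1.
pose e : 'rV[R]_nS := map_mx (Num.max 1) d.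
pose Z := ctr T *m diag_mx (rmx e) *m T.
have eP : forall i, 0 <= (e - d) 0 i.
  by move=> i; rewrite !mxE subr_ge0 le_max lexx orbT.
have eQ : forall i, 0 <= (e - const_mx 1) 0 i.
  by move=> i; rewrite !mxE subr_ge0 le_max lexx.
have pZP : psd (Z - Ci - ctr HD *m HD).
  rewrite -addrA -opprD PT /Z -mulmxBl -mulmxBr -raddfB -map_mxB.
  exact: psd_diag_form.
have pZQ : psd (Z - Ci - ctr HR *m HR).
  have := psd_diag_form T eQ; rewrite map_mxB raddfB /= map_const_mx.
  by rewrite diag_const_mx mulmxBr mulmxBl mulmx1 -QT opprD addrA.
have [K WK] : exists K : 'M[C]_nS, Z - Ci = ctr K *m K.
  apply: psd_factor; rewrite -[Z - Ci](subrK (ctr HD *m HD)).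
  exact: psdD pZP (psd_gram _).
pose J := [set i | 1 < d 0 i]%SET.
pose sel : 'M[C]_(nS, #|J|) := colsub (@enum_val _ (mem J)) 1%:M.
have g_inj : injective (@enum_val _ (mem J)) := @enum_val_inj _ _.
pose X := invmx T *m sel.
have XT : ctr X *m ctr T = ctr sel by rewrite -ctrM /X mulKVmx.
have TX : T *m X = sel by rewrite /X mulKVmx.
have selsel : ctr sel *m sel = 1%:M.
  have := diag_colsub_congr (const_mx 1) g_inj.
  rewrite map_const_mx diag_const_mx mulmx1 => ->.
  by rewrite -[colsub _ _]/(mxsub _ _ _) mxsub_const map_const_mx diag_const_mx.
pose G := ctr X *m Ci *m X.
have pG : pd G.
  (* The left inverse of [X] is [X^H T^H T]. *)
  by apply: pd_congr pCi; rewrite -selsel -XT -TX mulmxA.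
have uG := pd_unit pG.
pose V := X *m invmx G *m ctr X.
have pV : psd V by apply/psd_congrV/pd_psd/pd_inv.
have VCV : V *m Ci *m V = V.
  have -> : V *m Ci *m V = X *m invmx G *m G *m invmx G *m ctr X.
    by rewrite /V /G !mulmxA.
  by rewrite (mulmxKV uG).
have pCV : psd (Cm - V).
  (* Expanding the right side gives [C - 2 V + V C^-1 V], and [V C^-1 V = V]. *)
  have -> : Cm - V = ctr (Cm - V) *m Ci *m (Cm - V).
    rewrite ctrB pC.1 pV.1 mulmxBl mulmxV // mulmxBr mulmxBl mul1mx mulmxBl mul1mx.
    by rewrite VCV mulmxKV // subrr subr0.
  exact/psd_congr/pd_psd.
exists K, V; rewrite -WK.
split; [exact: pZP | exact: pZQ | exact: pV | exact: pCV |].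
have detC m (H : 'M[C]_(m, nS)) :
  \det (1%:M + H *m Cm *m ctr H) * \det Ci = \det (Ci + ctr H *m H).
  have := det_add1_compress H 1%:M uCi.
  by rewrite invmxK ctr1 !(mul1mx, mulmx1).
have detV m (H : 'M[C]_(m, nS)) :
  \det (1%:M + H *m V *m ctr H) * \det G = \det (ctr X *m (Ci + ctr H *m H) *m X).
  by rewrite det_add1_compress // mulmxDr mulmxDl.
have detK : \det (1%:M + K *m Cm *m ctr K) * \det Ci = \det Z.
  by rewrite detC -WK (addrC Ci) (subrK Ci Z).
have detQ : \det (1%:M + HR *m Cm *m ctr HR) * \det Ci = \det (ctr T *m T).
  by rewrite detC QT.
(* The columns of [X] are orthonormal for the form [C^-1 + HR^H HR = T^H T]. *)
have detHR : \det (1%:M + HR *m V *m ctr HR) * \det G = 1.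
  by rewrite detV QT mulmxA XT -mulmxA TX selsel det1.
have detHD : \det (1%:M + HD *m V *m ctr HD) * \det G = \prod_(i in J) (d 0 i)%:C.
  rewrite detV PT !mulmxA XT (mulmxK uT) diag_colsub_congr // det_diag.
  rewrite (big_enum_val (fun i => (d 0 i)%:C)).
  by apply: eq_bigr => i _; rewrite !mxE.
(* Indices outside [J] contribute [max (1, d_i) = 1]. *)
have detZ : \det Z = \det (ctr T *m T) * \prod_(i in J) (d 0 i)%:C.
  rewrite det_diag_form rmorph_prod [in RHS]big_mkcond; congr (_ * _).
  by apply: eq_bigr => i _; rewrite !mxE inE; case: ltP.
have Ci0 : \det Ci != 0 by rewrite lt0r_neq0 ?det_pd.
have G0 : \det G != 0 by rewrite lt0r_neq0 ?det_pd.
(* What is left is scalar algebra: multiply by the nonzero [det C^-1] and [det G], and substitute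
   the four evaluations. *)
move: detK detQ detHR detHD Ci0 G0; rewrite detZ.
move: (\det (_ + K *m _ *m _)) (\det (_ + HR *m Cm *m _)) => x1 x2.
move: (\det (_ + HR *m _ *m _)) (\det (_ + HD *m _ *m _)) => x3 x4.
move: (\det Ci) (\det G) => c g cK cQ gR gD c0 g0.
apply: (mulIf g0); apply: (mulIf c0).
by rewrite (mulrAC x4) gD -(mulrA _ x2) cQ -(mulrA x1) gR mulr1 cK mulrC.
Qed.

End Determinants.

(** * Logarithms of positive complex determinants *)

Section Rates.
Variable R : realType.
Local Notation C := (R[i]).
Local Notation rmx := (map_mx (real_complex R)).

Lemma ln2_gt0 : 0 < ln 2 :> R.
Proof. by rewrite ln_gt0 // ltr1n. Qed.

Lemma log2M (x y : R) : 0 < x -> 0 < y -> log2 (x * y) = log2 x + log2 y.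
Proof. by move=> x0 y0; rewrite /log2 lnM ?posrE // mulrDl. Qed.

Lemma log2_div (x y : R) : 0 < x -> 0 < y -> log2 (x / y) = log2 x - log2 y.
Proof. by move=> x0 y0; rewrite /log2 ln_div ?posrE // mulrBl. Qed.

Lemma ler_log2 (x y : R) : 0 < x -> x <= y -> log2 x <= log2 y.
Proof.
move=> x0 xy; rewrite /log2 ler_pM2r ?invr_gt0 ?ln2_gt0 //.
by rewrite ler_ln ?posrE // (lt_le_trans x0).
Qed.

Lemma log2_prod n (f : 'I_n -> R) : (forall i, 0 < f i) ->
  log2 (\prod_i f i) = \sum_i log2 (f i).
Proof.
move=> f0; suff [] : 0 < \prod_i f i /\ log2 (\prod_i f i) = \sum_i log2 (f i) by [].
elim/big_rec2: _ => [|i y x _ [x0 E]]; first by rewrite /log2 ln1 mul0r ltr01.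
by rewrite log2M // E mulr_gt0.
Qed.

Lemma log2_concave1 (t d : R) : 0 <= t <= 1 -> 0 < d ->
  (1 - t) * log2 d <= log2 (t + (1 - t) * d).
Proof.
move=> /andP[t0 t1] d0; rewrite /log2 mulrA ler_pM2r ?invr_gt0 ?ln2_gt0 //.
have := @concave_ln R (Itv01 t0 t1) 1 d ltr01 d0.
by rewrite !convRE ln1 mulr0 mulr1 add0r.
Qed.

Lemma Re_gt0 (z : C) : 0 < z -> 0 < complex.Re z.
Proof. by rewrite ltcE => /andP[]. Qed.

Lemma ler_Re (z w : C) : z <= w -> complex.Re z <= complex.Re w.
Proof. by rewrite lecE => /andP[]. Qed.

(** A positive element of [R[i]] has zero imaginary part. *)
Lemma ReM_gt0 (z w : C) : 0 < z -> 0 < w ->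
  complex.Re (z * w) = complex.Re z * complex.Re w.
Proof.
case: z w => [a b] [a' b']; rewrite !ltcE /= => /andP[/eqP -> _] /andP[/eqP -> _].
by rewrite mulr0 subr0.
Qed.

Lemma log2_ReM (z w : C) : 0 < z -> 0 < w ->
  log2 (complex.Re (z * w)) = log2 (complex.Re z) + log2 (complex.Re w).
Proof. by move=> z0 w0; rewrite ReM_gt0 // log2M ?Re_gt0. Qed.

Lemma log2_Re_ratio (a b c : C) : 0 < a -> 0 < b -> 0 < c ->
  log2 (complex.Re a) + log2 (complex.Re b / complex.Re c)
  = log2 (complex.Re (a * b)) - log2 (complex.Re c).
Proof. by move=> a0 b0 c0; rewrite log2_div ?Re_gt0 // addrA log2_ReM. Qed.

(** * Concavity of the log-determinant *)

Lemma log2det_diag_form n (T : 'M[C]_n) (d : 'rV[R]_n) :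
  T \in unitmx -> (forall i, 0 < d 0 i) ->
  log2det (ctr T *m diag_mx (rmx d) *m T)
  = log2det (ctr T *m T) + \sum_i log2 (d 0 i).
Proof.
move=> uT d0; rewrite /log2det det_diag_form log2_ReM ?det_gram_gt0 //.
  by rewrite log2_prod.
by rewrite ltcR prodr_gt0.
Qed.

Lemma log2det_concave n (P Q : 'M[C]_n) (t : R) : pd P -> pd Q -> 0 <= t <= 1 ->
  t * log2det P + (1 - t) * log2det Q
  <= log2det (t%:C *: P + (1 - t)%:C *: Q).
Proof.
move=> pP pQ t01; have [T [d [uT PT QT]]] := simdiag pP pQ.1.
have d0 i : 0 < d 0 i.
  rewrite lt0r (diag_form (T := T)) -?QT ?andbT //; last exact: pd_psd.
  (* A zero [d_i] would make [det Q] vanish. *)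
  have := det_pd pQ; rewrite QT det_diag_form => /lt0r_neq0.
  rewrite mulf_eq0 negb_or => /andP[_]; apply: contraNneq => di0.
  by rewrite (bigD1 i) //= di0 mul0r.
pose m : 'rV[R]_n := const_mx t + (1 - t) *: d.
have m0 i : 0 < m 0 i.
  rewrite !mxE; have /andP[t0 t1] := t01; have [->|tn1] := eqVneq t 1.
    by rewrite subrr mul0r addr0 ltr01.
  by rewrite ltr_wpDl // mulr_gt0 // subr_gt0 lt_neqAle tn1.
have -> : t%:C *: P + (1 - t)%:C *: Q = ctr T *m diag_mx (rmx m) *m T.
  have -> : diag_mx (rmx m) = t%:C%:M + (1 - t)%:C *: diag_mx (rmx d).
    by apply/matrixP=> i j; rewrite !mxE rmorphD rmorphM mulrnDl mulrnAr.
  rewrite mulmxDr mulmxDl mul_mx_scalar QT PT.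
  by rewrite -!scalemxAr -!scalemxAl.
(* The weights recombine the common term [log2det (T^H T)], leaving scalar concavity between [1] and
   each [d_i]. *)
rewrite QT PT !log2det_diag_form // mulrDr addrA -mulrDl (addrC t) subrK mul1r.
rewrite lerD2l mulr_sumr; apply: ler_sum => i _.
by rewrite !mxE log2_concave1.
Qed.

(** * Concavity of the rates and convexity of the feasible set *)

Lemma RA_le nS nR nD nK (HD : 'M[C]_(nD, nS)) (HR : 'M[C]_(nR, nS))
    (K : 'M[C]_(nK, nS)) (Cm V W : 'M[C]_nS) :
  psd (ctr K *m K - ctr HD *m HD) -> psd (ctr K *m K - ctr HR *m HR) ->
  psd V -> psd W -> psd (Cm - (V + W)) ->
  RA HD HR V W <= log2det (1%:M + K *m Cm *m ctr K).
Proof.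
move=> pKD pKR pV pW pCm; have pVW := psdD pV pW.
have pC : psd Cm by rewrite -(subrK (V + W) Cm); exact: psdD pCm pVW.
have pWE : psd (V + W - V) by rewrite addrC addKr.
have D0 := det_pd (pd_add1 HD pV); have R0 := det_pd (pd_add1 HR pV).
have S0 := det_pd (pd_add1 HR pVW); have K0 := det_pd (pd_add1 K pC).
rewrite /RA (log2_Re_ratio D0 S0 R0) lerBlDr /log2det -(log2_ReM K0 R0).
apply: ler_log2; first exact/Re_gt0/mulr_gt0.
exact/ler_Re/(weak_duality pKD pKR pV pWE pCm).
Qed.

Lemma RA_attained nS nR nD (HD : 'M[C]_(nD, nS)) (HR : 'M[C]_(nR, nS))
    (Cm : 'M[C]_nS) : pd Cm ->
  exists K V : 'M[C]_nS,
    [/\ psd (ctr K *m K - ctr HD *m HD), psd (ctr K *m K - ctr HR *m HR),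
        psd V, psd (Cm - V) &
        RA HD HR V (Cm - V) = log2det (1%:M + K *m Cm *m ctr K)].
Proof.
move=> pC; have [K [V [pKD pKR pV pCV E]]] := strong_duality HD HR pC.
exists K, V; split; [exact: pKD | exact: pKR | exact: pV | exact: pCV |].
have D0 := det_pd (pd_add1 HD pV); have R0 := det_pd (pd_add1 HR pV).
have S0 := det_pd (pd_add1 HR (pd_psd pC)).
have K0 := det_pd (pd_add1 K (pd_psd pC)).
rewrite /RA (addrC V) subrK (log2_Re_ratio D0 S0 R0) E (log2_ReM K0 R0).
exact: addrK.
Qed.

(** Splits a constant, such as [I] in a log-determinant or the floor [eps I], along a convex
    combination. *)
Lemma convex_id (V : lmodType C) (t : R) (v : V) : t%:C *: v + (1 - t)%:C *: v = v.
Proof. by rewrite -scalerDl -rmorphD addrC subrK scale1r. Qed.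

Lemma convex_congr m n (H : 'M[C]_(m, n)) (A B : 'M[C]_n) (t : R) :
  H *m (t%:C *: A + (1 - t)%:C *: B) *m ctr H
  = t%:C *: (H *m A *m ctr H) + (1 - t)%:C *: (H *m B *m ctr H).
Proof. by rewrite mulmxDr mulmxDl -!scalemxAr -!scalemxAl. Qed.

Lemma log2det_add1_concave m n (H : 'M[C]_(m, n)) (A B : 'M[C]_n) (t : R) :
  psd A -> psd B -> 0 <= t <= 1 ->
  t * log2det (1%:M + H *m A *m ctr H) + (1 - t) * log2det (1%:M + H *m B *m ctr H)
  <= log2det (1%:M + H *m (t%:C *: A + (1 - t)%:C *: B) *m ctr H).
Proof.
move=> pA pB t01.
apply: le_trans (log2det_concave (pd_add1 H pA) (pd_add1 H pB) t01) _.
by rewrite convex_congr !scalerDr addrACA convex_id.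
Qed.

Lemma RB_concave nS nR nD (HDS : 'M[C]_(nD, nS)) (HDR : 'M[C]_(nD, nR))
    (C1 C2 : 'M[C]_nS) (R1 R2 : 'M[C]_(nS + nR)) (t : R) :
  psd C1 -> psd C2 -> psd R1 -> psd R2 -> 0 <= t <= 1 ->
  t * RB HDS HDR C1 R1 + (1 - t) * RB HDS HDR C2 R2
  <= RB HDS HDR (t%:C *: C1 + (1 - t)%:C *: C2) (t%:C *: R1 + (1 - t)%:C *: R2).
Proof.
move=> pC1 pC2 pR1 pR2 t01; rewrite /RB; set H := Hmat _ _.
apply: le_trans (log2det_concave _ _ t01) _.
- exact: pdD (pd_add1 _ pC1) (psd_congrV _ pR1).
- exact: pdD (pd_add1 _ pC2) (psd_congrV _ pR2).
by rewrite !convex_congr !scalerDr addrACA (addrACA (t%:C *: 1%:M)) convex_id.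
Qed.

(** The floor [eps I] supplies the invertibility of [C] on which [strong_duality] relies. *)
Lemma pd_loew n (eps : R) (A : 'M[C]_n) : 0 < eps -> loew (eps%:C *: 1%:M) A -> pd A.
Proof.
move=> e0 pA; rewrite -(subrK (eps%:C *: 1%:M) A) addrC.
exact: pdD (pdZ e0 (pd1 _ _)) pA.
Qed.

Lemma RAstar_le nS nR nD nK (HD : 'M[C]_(nD, nS)) (HR : 'M[C]_(nR, nS))
    (K : 'M[C]_(nK, nS)) (Cm : 'M[C]_nS) :
  psd (ctr K *m K - ctr HD *m HD) -> psd (ctr K *m K - ctr HR *m HR) -> psd Cm ->
  RAstar HD HR Cm <= log2det (1%:M + K *m Cm *m ctr K).
Proof.
move=> pKD pKR pC; apply: ge_sup.
  (* Bounding [sup] from above requires a nonempty set; the zero pair is feasible. *)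
  exists (RA HD HR 0 0), 0, 0.
  split; [exact: psd0 | exact: psd0 | | by []].
  by rewrite /loew addr0 subr0; exact: pC.
by move=> _ [V [W [pV pW pCm ->]]]; exact: RA_le pKD pKR pV pW pCm.
Qed.

(** The pair [(V, C - V)] from strong duality is feasible and meets the upper bound, so for such [C]
    the supremum is a maximum. *)
Lemma RAstar_attained nS nR nD (HD : 'M[C]_(nD, nS)) (HR : 'M[C]_(nR, nS))
    (Cm : 'M[C]_nS) : pd Cm ->
  exists K : 'M[C]_nS,
    [/\ psd (ctr K *m K - ctr HD *m HD), psd (ctr K *m K - ctr HR *m HR) &
        log2det (1%:M + K *m Cm *m ctr K) <= RAstar HD HR Cm].
Proof.
move=> pC; have [K [V [pKD pKR pV pCV E]]] := RA_attained HD HR pC.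
exists K; split; [exact: pKD | exact: pKR |].
have attained : exists Cv Cw : 'M[C]_nS, [/\ psd Cv, psd Cw, loew (Cv + Cw) Cm
    & log2det (1%:M + K *m Cm *m ctr K) = RA HD HR Cv Cw].
  exists V, (Cm - V); split; [exact: pV | exact: pCV | | by rewrite E].
  by rewrite /loew (addrC V) subrK subrr; exact: psd0.
apply: (sup_upper_bound _ attained); split; first by eexists; exact: attained.
exists (log2det (1%:M + K *m Cm *m ctr K)).
by move=> _ [V' [W [pV' pW pCm ->]]]; exact: RA_le pKD pKR pV' pW pCm.
Qed.

Lemma RAstar_concave nS nR nD (HD : 'M[C]_(nD, nS)) (HR : 'M[C]_(nR, nS))
    (C1 C2 : 'M[C]_nS) (t : R) :
  psd C1 -> psd C2 -> pd (t%:C *: C1 + (1 - t)%:C *: C2) -> 0 <= t <= 1 ->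
  t * RAstar HD HR C1 + (1 - t) * RAstar HD HR C2
  <= RAstar HD HR (t%:C *: C1 + (1 - t)%:C *: C2).
Proof.
(* [K] is optimal at the convex combination; at the endpoints it only has to give upper bounds. *)
move=> pC1 pC2 pC t01; have [K [pKD pKR KC]] := RAstar_attained HD HR pC.
apply: le_trans KC; apply: le_trans (log2det_add1_concave K pC1 pC2 t01).
have /andP[t0 t1] := t01.
apply: lerD; apply: ler_wpM2l; rewrite ?subr_ge0 //.
- exact: RAstar_le pKD pKR pC1.
- exact: RAstar_le pKD pKR pC2.
Qed.

Lemma Peps_convex nS nR (PS PR eps : R) (C1 C2 : 'M[C]_nS)
    (R1 R2 : 'M[C]_(nS + nR)) (t : R) :
  Peps PS PR eps C1 R1 -> Peps PS PR eps C2 R2 -> 0 <= t <= 1 ->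
  Peps PS PR eps (t%:C *: C1 + (1 - t)%:C *: C2) (t%:C *: R1 + (1 - t)%:C *: R2).
Proof.
move=> [pC1 pR1 S1 P1] [pC2 pR2 S2 P2] /andP[t0 t1].
have t1' : 0 <= 1 - t by rewrite subr_ge0.
have le_convex (a b c : C) : a <= c -> b <= c -> t%:C * a + (1 - t)%:C * b <= c.
  move=> ac bc; rewrite -[leRHS](@convex_id C^o t).
  by apply: lerD; apply: ler_wpM2l; rewrite ?ler0c.
split.
- rewrite /loew -(@convex_id _ t (eps%:C *: _)) opprD addrACA -!scalerBr.
  by apply: psdD; apply: psdZ.
- by apply: psdD; apply: psdZ.
- rewrite convex_congr !linearD !linearZ /= addrACA -!mulrDr.
  exact: le_convex.
- by rewrite convex_congr !linearD !linearZ /=; exact: le_convex.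
Qed.

End Rates.

Unset Implicit Arguments.

Theorem theorem1 (R : realType) (nS nR nD : nat)
  (HDS : 'M[R[i]]_(nD, nS)) (HRS : 'M[R[i]]_(nR, nS)) (HDR : 'M[R[i]]_(nD, nR))
  (PS PR : R) :
  (1 <= nS)%N -> (1 <= nR)%N -> (1 <= nD)%N -> 0 < PS -> 0 < PR ->
  forall eps : R, 0 < eps ->
  (* P_eps is convex *)
  (forall (C1 C2 : 'M[R[i]]_nS) (R1 R2 : 'M[R[i]]_(nS + nR)) (t : R),
      Peps PS PR eps C1 R1 -> Peps PS PR eps C2 R2 -> 0 <= t <= 1 ->
      Peps PS PR eps (t%:C *: C1 + (1 - t)%:C *: C2)
                     (t%:C *: R1 + (1 - t)%:C *: R2)) /\
  (* the objective is concave on P_eps *)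
  (forall (C1 C2 : 'M[R[i]]_nS) (R1 R2 : 'M[R[i]]_(nS + nR)) (t : R),
      Peps PS PR eps C1 R1 -> Peps PS PR eps C2 R2 -> 0 <= t <= 1 ->
      t * objective HDS HRS HDR C1 R1 + (1 - t) * objective HDS HRS HDR C2 R2
      <= objective HDS HRS HDR (t%:C *: C1 + (1 - t)%:C *: C2)
                               (t%:C *: R1 + (1 - t)%:C *: R2)).
Proof.
move=> _ _ _ _ _ eps eps0; split=> C1 C2 R1 R2 t P1 P2 t01.
  exact: Peps_convex.
have [pC _ _ _] := Peps_convex P1 P2 t01.
have {}pC := pd_loew eps0 pC.
have [/(pd_loew eps0)/pd_psd pC1 pR1 _ _] := P1.
have [/(pd_loew eps0)/pd_psd pC2 pR2 _ _] := P2.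
have /andP[t0 t1] := t01; rewrite -subr_ge0 in t1.
(* The minimum at each endpoint is at most either rate there, so concavity of each rate suffices. *)
rewrite /objective le_min; apply/andP; split.
  apply: le_trans (RAstar_concave HDS HRS pC1 pC2 pC t01).
  by apply: lerD; apply: ler_wpM2l; rewrite ?ge_min ?lexx.
apply: le_trans (RB_concave HDS HDR pC1 pC2 pR1 pR2 t01).
by apply: lerD; apply: ler_wpM2l; rewrite ?ge_min ?lexx ?orbT.
Qed.
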